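(* Let $G$ be a graph. An ERR:LD set for $G$ exists if and only if $\delta(G) \ge 2$ and $G$ is twin-free.
   Context: Graphs are simple and undirected; $\delta(G)$ is the minimum degree. $N(v)$ is the open neighborhood of $v$ and $N[v]=N(v)\cup\{v\}$. Two distinct vertices $u,v$ are twins if $N[u]=N[v]$ or $N(u)=N(v)$; a graph is twin-free if it has no twins. ERR:LD sets (error-correcting locating-dominating sets): $S \subseteq V(G)$ is a set of detectors. At most one intruder is present, located at some vertex of $G$. A correctly working detector $v\in S$ transmits $2$ if the intruder is at $v$, $1$ if the intruder is in $N(v)$, and $0$ otherwise (including when there is no intruder). At most one detector may transmit an incorrect value (any wrong value in $\{0,1,2\}$). $S$ is an ERR:LD set if, from the transmitted values, one can always determine whether an intruder is present and, if so, its exact location. Formally: for each scenario $x \in V(G)\cup\{\text{no intruder}\}$ let $\sigma_x : S \to \{0,1,2\}$ be the corresponding correct transmission; $S$ is an ERR:LD set if for any two distinct scenarios $x,y$ there is no function $f: S\to\{0,1,2\}$ which differs from $\sigma_x$ in at most one detector and also differs from $\sigma_y$ in at most one detector. Equivalently: $|N[v] \cap S| \ge 3$ for all $v\in V(G)$, and $|((N(v) \cap S) \triangle (N(u) \cap S)) - \{v,u\}| \ge 3 - |\{v,u\}\cap S|$ for all distinct $u,v\in V(G)$. *)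

(* Defs.v *)
From mathcomp Require Import all_boot all_order all_algebra.
From mathcomp Require Import all_classical constructive_ereal.

Set Implicit Arguments.
Unset Strict Implicit.
Unset Printing Implicit Defensive.

Local Open Scope classical_set_scope.
Local Open Scope card_scope.

(* The vertex type is arbitrary: infinite graphs, and vertices of infinite
   degree, are allowed. *)
Record graph := Graph {
  vertex :> Type;
  adj : vertex -> vertex -> Prop;
  adj_sym : forall u v, adj u v -> adj v u;
  adj_irrefl : forall v, ~ adj v v
}.

Section GraphDefs.
Variable G : graph.
Implicit Types (u v : G) (S : set G).

Definition open_nbhd v : set G := [set u | adj v u].

Definition closed_nbhd v : set G := open_nbhd v `|` [set v].

(* Degrees live in \bar int in order to have +oo as a value: [xget] returns
   the number of neighbours of v when it is finite, and +oo otherwise. *)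
Definition degree v : \bar int :=
  xget +oo%E [set d | exists2 n : nat, open_nbhd v #= `I_n & d = (n%:Z)%:E%E].

(* The least element of the set of degrees, which exists as soon as there is
   a vertex; the default value +oo is the minimum over the empty family. *)
Definition min_degree : \bar int :=
  xget +oo%E (range degree `&` lbound (range degree)).

Definition twins u v : Prop :=
  u <> v /\ (closed_nbhd u = closed_nbhd v \/ open_nbhd u = open_nbhd v).

Definition twin_free : Prop := forall u v, ~ twins u v.

(* The correct transmission of the detectors in S; a scenario is [Some v] when
   the intruder is at v and [None] when there is no intruder. *)
Definition signal S (x : option G) (d : S) : 'I_3 :=
  if x is Some v then
    if `[< v = val d >] then inord 2
    else if `[< open_nbhd (val d) v >] then inord 1
    else inord 0
  else inord 0.

Definition at_most_one_error S (f g : S -> 'I_3) : Prop :=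
  is_subset1 [set d | f d <> g d].

Definition ERR_LD S : Prop :=
  forall x y : option G, x <> y ->
    ~ exists f : S -> 'I_3,
        at_most_one_error f (signal x) /\ at_most_one_error f (signal y).

End GraphDefs.

Arguments min_degree G : clear implicits.
Arguments twin_free G : clear implicits.

(* Main.v *)
Require Import Defs.
From mathcomp Require Import all_boot all_order all_algebra.
From mathcomp Require Import all_classical constructive_ereal.

(* Two scenarios can be confused exactly when their correct transmissions
   differ in at most two detectors: the faulty transmission then agrees with one
   of them at the first detector and with the other elsewhere. The scenarios
   "no intruder" and v differ exactly on the detectors in N[v], while u and v
   differ on {u, v} and wherever N(u) and N(v) differ outside {u, v}. Hence
   degree at least 2 and twin-freeness are forced, and when they hold the set of
   all vertices works. *)

Set Implicit Arguments.
Unset Strict Implicit.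
Unset Printing Implicit Defensive.

Import Order.TTheory GRing.Theory Num.Theory.
Local Open Scope classical_set_scope.
Local Open Scope card_scope.

Lemma card_le_I2P (T : Type) (A : set T) :
  `I_2 #<= A <-> exists a b, [/\ a <> b, A a & A b].
Proof.
split=> [I2A|[a [b [ab Aa Ab]]]].
  apply: contrapT => A_sub1.
  have [[a Aa]|/set0P/negP/negPn/eqP A0] := pselect (A !=set0).
    have Asub : A `<=` [set a].
      by move=> b Ab /=; apply: contrapT => ba; apply: A_sub1; exists b, a.
    have := card_le_trans I2A (subset_card_le Asub).
    by rewrite (card_le_eqr (@card_set1 _ a)) card_le_II.
  by move: I2A; rewrite A0 card_le0 => /eqP/IIn_eq0.
have ab2 : [set a; b] #= `I_2.
  apply/eq_cardSP; exists a; first by left.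
  suff -> : [set a; b] `\ a = [set b] by exact: card_set1.
  apply/seteqP; split=> [x [[->|->] /= xa]//|x ->].
  by split; [right | move=> /esym].
by rewrite -(card_le_eql ab2); apply: subset_card_le => x [->|->].
Qed.

(** Pigeonhole: [p] and [q] cannot cover three distinct points. In use, [P] holds at the vertices
    whose detectors tell two scenarios apart. *)
Lemma exists_off_pair (T : Type) (P : T -> Prop) (a b c p q : T) :
  a <> b -> b <> c -> a <> c -> P a -> P b -> P c ->
  exists d, [/\ P d, d <> p & d <> q].
Proof.
move=> ab bc ac Pa Pb Pc.
apply: contrapT => no.
have off d : P d -> d = p \/ d = q.
  move=> Pd; apply: contrapT => /not_orP[dp dq].
  by apply: no; exists d.
by case: (off _ Pa) (off _ Pb) (off _ Pc)
  => [->|->] [->|->] [->|->] in ab bc ac *.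
Qed.

Lemma inord_inj3 (m n : nat) :
  inord m = inord n :> 'I_3 -> m < 3 -> n < 3 -> m = n.
Proof. by move=> /(congr1 (@nat_of_ord 3)) + m3 n3; rewrite !inordK. Qed.

Section Degree.
Variable G : graph.
Implicit Type v : G.

Lemma degree_ge (n : nat) v :
  ((n%:Z)%:E <= degree v)%E = (`I_n #<= open_nbhd v).
Proof.
rewrite /degree; case: xgetP => [d _ [m Nm ->]|noP].
  by rewrite lee_fin lez_nat -card_le_II (card_le_eqr Nm).
(* Here the degree is the default [+oo]; the neighbourhood is infinite and so receives an injection
   from every [I_n]. *)
rewrite leey; apply/esym; apply: (card_le_trans (card_leT `I_n)).
apply/infiniteP => /finite_setP[m Nm].
by apply: (noP (m%:Z)%:E%E); exists m.
Qed.

Lemma degreeE v : (exists n : nat, degree v = (n%:Z)%:E%E) \/ degree v = +oo%E.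
Proof.
by rewrite /degree; case: xgetP => [d _ [m _ ->]|_]; [left; exists m | right].
Qed.

Lemma min_degree_ge (x : \bar int) :
  (x <= min_degree G)%E <-> forall v, (x <= degree v)%E.
Proof.
rewrite /min_degree; case: xgetP => [d _ [[v _ <-] min_v]|no_min].
  split=> [xv u|]; last exact.
  by apply: le_trans xv _; apply: min_v; exists u.
rewrite leey; split=> // _ v.
have [[n vn]|->] := degreeE v; last exact: leey.
(* A vertex of finite degree would give, by well-ordering of the naturals, a least finite degree; it
   also bounds the infinite ones, so the minimum would be attained. *)
have ex_n : exists n, `[< exists u : G, degree u = (n%:Z)%:E%E >].
  by exists n; apply/asboolP; exists v.
have [m /asboolP[u um] min_m] := ex_minnP ex_n.
exfalso; apply: (no_min (degree u)); split; first by exists u.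
move=> _ [w _ <-]; rewrite um.
have [[k wk]|->] := degreeE w; last exact: leey.
rewrite wk lee_fin lez_nat; apply: min_m.
by apply/asboolP; exists w.
Qed.

End Degree.

Section Detection.
Variables (G : graph) (S : set G).
Implicit Types (x y : option G) (d : S) (u v : G).

(** Saying that no two vertices [p], [q], possibly equal or outside [S], cover the distinguishing
    detectors replaces a count of at least three. *)
Lemma ERR_LDP :
  ERR_LD S <-> forall x y, x <> y -> forall p q : G,
    exists d, [/\ signal x d <> signal y d, val d <> p & val d <> q].
Proof.
split=> [ldS x y xy p q|sep x y xy [f [fx fy]]].
  apply: contrapT => no; apply: (ldS x y xy).
  have off d : signal x d <> signal y d -> val d = p \/ val d = q.
    move=> xyd; apply: contrapT => /not_orP[dp dq].
    by apply: no; exists d.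
  (* This transmission errs against [signal y] only at [p], and against [signal x] only at [q]. *)
  exists (fun d => if `[< val d = p >] then signal x d else signal y d).
  split=> d e /=; case: asboolP => // dp; case: asboolP => // ep xyd xye;
    apply: val_inj; last exact: etrans dp (esym ep).
  have [//|dq] := off d (nesym xyd); have [//|eq] := off e (nesym xye).
  exact: etrans dq (esym eq).
(* Distinct scenarios involve some vertex; [o] stands in for the faulty position when no detector
   errs. *)
have [o] : exists o : G, True.
  case: x y xy {fx fy} => [v|] [w|] // _; by [exists v | exists w].
move=> _.
have single g : at_most_one_error f g ->
    exists p, forall d, f d <> g d -> val d = p.
  move=> fg; have [[d fgd]|no] := pselect (exists d, f d <> g d).
    by exists (val d) => e fge; congr val; apply: fg.
  by exists o => d fgd; case: no; exists d.
have [[p fxp] [q fyq]] := (single _ fx, single _ fy).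
have [d [xyd dp dq]] := sep x y xy p q.
apply: xyd; transitivity (f d).
  by apply: contrapT => fd; apply: dp; apply: fxp; exact: nesym.
by apply: contrapT => fd; apply: dq; exact: fyq.
Qed.

Lemma signal_self d : signal (Some (val d)) d = inord 2.
Proof. by rewrite /signal asboolT. Qed.

Lemma signal_off v d : val d <> v ->
  signal (Some v) d = if `[< adj v (val d) >] then inord 1 else inord 0.
Proof.
move=> dv; rewrite /signal asboolF; last by move=> /esym.
by rewrite (@asbool_equiv_eq _ (adj v (val d))) //; split; exact: adj_sym.
Qed.

Lemma signal_None_neq v d :
  signal None d <> signal (Some v) d <-> closed_nbhd v (val d).
Proof.
have [<-|dv] := pselect (val d = v).
  split=> [_|_]; first by right.
  by rewrite signal_self => /inord_inj3 => /(_ isT isT).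
rewrite signal_off //; case: asboolP => [vd|nvd]; split=> //.
- by left.
- by move=> _ /inord_inj3 => /(_ isT isT).
- by case.
Qed.

Lemma signal_self_neq v d : val d <> v ->
  signal (Some (val d)) d <> signal (Some v) d.
Proof.
move=> dv; rewrite signal_self signal_off //.
by case: ifP => _ /inord_inj3 => /(_ isT isT).
Qed.

Lemma signal_off_neq u v d : val d <> u -> val d <> v ->
  signal (Some u) d <> signal (Some v) d <-> ~ (adj u (val d) <-> adj v (val d)).
Proof.
move=> du dv; rewrite !signal_off //.
case: asboolP => ud; case: asboolP => vd; split=> //.
- by move=> [].
- by move=> _ [/(_ ud)].
- by move=> _ /inord_inj3 => /(_ isT isT).
- by move=> _ [_ /(_ vd)].
- by move=> _ /inord_inj3 => /(_ isT isT).
- by move=> [].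
Qed.

(** One of the two exclusions is spent on [v] itself, so a detector of the closed neighbourhood that
    remains is a true neighbour; the other exclusion makes the second neighbour differ from the
    first. *)
Lemma ERR_LD_two_neighbours v : ERR_LD S ->
  exists a b, [/\ a <> b, open_nbhd v a & open_nbhd v b].
Proof.
move=> /ERR_LDP sep.
have nbr p : exists a, open_nbhd v a /\ a <> p.
  have [//|d [/signal_None_neq[vd|//] _ dp]] := sep None (Some v) _ v p.
  by exists (val d).
have [a [va _]] := nbr v; have [b [vb ba]] := nbr a.
by exists b, a.
Qed.

(** With [u] and [v] excluded, a detector can separate them only by adjacency, and twins have the
    same neighbours outside the pair. *)
Lemma ERR_LD_twin_free : ERR_LD S -> twin_free G.
Proof.
move=> /ERR_LDP sep u v [uv tw].
have [[]//|d [/[swap] du /[swap] dv]] := sep (Some u) (Some v) _ u v.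
rewrite signal_off_neq //; apply.
case: tw => [/seteqP[uv_sub vu_sub]|N_eq]; last first.
  by rewrite -[adj u _]/(open_nbhd u _) N_eq.
split=> [ud|vd].
- by case: (uv_sub (val d) (or_introl ud)).
- by case: (vu_sub (val d) (or_introl vd)).
Qed.

End Detection.

Lemma twin_free_witness (G : graph) (u v : G) : twin_free G -> u <> v ->
  exists w, [/\ w <> u, w <> v & ~ (adj u w <-> adj v w)].
Proof.
move=> tf uv; apply: contrapT => no.
have same w : w <> u -> w <> v -> adj u w <-> adj v w.
  by move=> wu wv; apply: contrapT => dif; apply: no; exists w.
apply: (tf u v); split=> //.
(* Agreement outside the pair makes [u] and [v] closed twins if adjacent, open twins if not; each
   equality is checked at [u], at [v] and elsewhere. *)
have [auv|nuv] := pselect (adj u v); [left | right]; apply/funext => w;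
  apply/propext; have [->|wu] := pselect (w = u);
  try have [->|wv] := pselect (w = v).
- split=> _; last by right.
  by left; exact: adj_sym.
- by split=> _; [right | left].
- split=> -[aw|//]; left; exact/(same w wu wv).
- by split=> [/adj_irrefl|/adj_sym].
- by split=> [|/adj_irrefl].
- exact: same.
Qed.

Lemma ERR_LD_setT (G : graph) :
  (forall v : G, exists a b, [/\ a <> b, open_nbhd v a & open_nbhd v b]) ->
  twin_free G -> ERR_LD [set: G].
Proof.
move=> deg2 tf; apply/ERR_LDP.
pose det (v : G) : [set: G] := to_setT v.
suff sep x y : x <> y -> forall p q,
    exists d, [/\ signal x (det d) <> signal y (det d), d <> p & d <> q].
  move=> x y xy p q; have [d [? ? ?]] := sep x y xy p q.
  by exists (det d).
have sepN v p q :
    exists d, [/\ signal None (det d) <> signal (Some v) (det d), d <> p & d <> q].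
  have [a [b [ab va vb]]] := deg2 v.
  have nv c : open_nbhd v c -> v <> c by move=> /[swap] <- /adj_irrefl.
  (* The three distinguishing detectors are [v] and its two neighbours. *)
  apply: (@exists_off_pair _ _ v a b) => //; try exact: nv;
    apply/signal_None_neq; [right | left | left] => //.
case: x y => [u|] [v|] // xy p q.
- have uv : u <> v by move=> uv; apply: xy; rewrite uv.
  have [w [wu wv dif]] := twin_free_witness tf uv.
  (* Here they are [u] and [v], each sending 2 for itself only, and the witness [w] against
     twins. *)
  apply: (@exists_off_pair _ _ u v w) => //; try exact/nesym.
  + exact: (@signal_self_neq _ _ _ (det u)).
  + exact/nesym/(@signal_self_neq _ _ _ (det v))/nesym.
  + exact/signal_off_neq.
- have [d [ud dp dq]] := sepN u p q.
  by exists d; split=> // /esym.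
Qed.

Theorem theorem2p5 (G : graph) :
  (exists S : set G, ERR_LD S) <->
  ((2%:Z)%:E <= min_degree G)%E /\ twin_free G.
Proof.
have deg2P : (((2%:Z)%:E <= min_degree G)%E) <->
    forall v : G, exists a b, [/\ a <> b, open_nbhd v a & open_nbhd v b].
  rewrite min_degree_ge; split=> deg v.
  - by apply/card_le_I2P; rewrite -degree_ge.
  - by rewrite degree_ge; apply/card_le_I2P.
rewrite deg2P; split=> [[S ldS]|[deg tf]].
- split=> [v|]; first exact: (ERR_LD_two_neighbours v ldS).
  exact: ERR_LD_twin_free ldS.
- by exists [set: G]; exact: ERR_LD_setT.
Qed.
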